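(* Let $\mathcal G$ be connected and $W$ doubly stochastic, with $\delta$ the contraction constant of $W$, and let every $f^i$ satisfy the smoothness and strong convexity assumptions (all as specified in the context). Let the step-size matrix $D=\mathrm{diag}(\alpha_1,\dots,\alpha_n)$ be such that its largest entry $\alpha_{\max}=\max_i\alpha_i$ satisfies $$\alpha_{\max}\in\left(0,\ \min\left\{\frac{(1-\delta)\left(1-\delta-4\sqrt{3}\,\bar\kappa(1-\kappa_D^{-1})\right)}{10L\delta\sqrt{n}\sqrt{\bar\kappa}},\ \frac{1}{2\bar L}\right\}\right),$$ where $\kappa_D=\alpha_{\max}/\alpha_{\min}$, $\alpha_{\min}=\min_i\alpha_i$, and $\bar\kappa=L/\bar\mu$. Define $$\lambda=\max\left\{\sqrt{12\bar\kappa^2(1-\kappa_D^{-1})^2+10L\delta\sqrt{n}\sqrt{\bar\kappa}\,\alpha_{\max}}+\delta+2\sqrt{3}\,\bar\kappa(1-\kappa_D^{-1}),\ \sqrt{1-\frac{\alpha_{\max}\bar\mu}{3}}\right\},$$ and assume that the step-size heterogeneity is small enough, namely $\kappa_D<1+\dfrac{\lambda-\delta}{4\sqrt{3}\,\bar\kappa}$. Then $\lambda\in(0,1)$, and the sequence $\{\boldsymbol x_k\}$ generated by the ATC-DIGing algorithm with step-size matrix $D$ converges to $\boldsymbol x^*=\mathbf 1(x^* )'$ at the global R-linear (geometric) rate $O(\lambda^k)$; that is, there is a constant $C>0$ such that $\|\boldsymbol x_k-\boldsymbol x^*\|_F\le C\lambda^k$ for all $k\ge 0$.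
   Context: Problem: $\min_{x\in\mathbb R^p} f(x)=\frac1n\sum_{i=1}^n f^i(x)$ with $f^i:\mathbb R^p\to\mathbb R$; $x^*$ is its (unique) minimizer. $\mathbf 1\in\mathbb R^n$ is the all-ones column vector, a prime denotes transpose, $\|\cdot\|_F$ is the Frobenius norm. Smoothness: every $f^i$ is differentiable and there is $L^i\in(0,+\infty)$ with $\|\nabla f^i(x)-\nabla f^i(y)\|_F\le L^i\|x-y\|_F$ for all $x,y\in\mathbb R^p$. Strong convexity: every $f^i$ satisfies $f^i(x)\ge f^i(y)+\langle\nabla f^i(y),x-y\rangle+\frac{\mu^i}{2}\|x-y\|_F^2$ for all $x,y\in\mathbb R^p$, where $\mu^i\in[0,+\infty)$ and at least one $\mu^i$ is nonzero. Set $L=\max_iL^i$, $\bar L=\frac1n\sum_iL^i$, $\bar\mu=\frac1n\sum_i\mu^i$. Network: $\mathcal G=(V,E)$ is a time-invariant undirected graph on $V=\{1,\dots,n\}$, and $W\in\mathbb R^{n\times n}$ is a nonnegative doubly stochastic matrix compliant with $\mathcal G$: $[W]_{ij}>0$ if $(j,i)\in E$ and $[W]_{ij}=0$ otherwise. Let $J=I-\frac1n\mathbf 1\mathbf 1'$ and $\|\boldsymbol y\|_J=\sqrt{\langle\boldsymbol y,J\boldsymbol y\rangle}=\|J\boldsymbol y\|_F$. The number $\delta\in(0,1)$ is a constant such that $\|W\boldsymbol y\|_J\le\delta\|\boldsymbol y\|_J$ for every $\boldsymbol y\in\mathbb R^{n\times p}$. ATC-DIGing algorithm: for $\boldsymbol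 x\in\mathbb R^{n\times p}$ with $i$-th row $(x^i)'$, let $\nabla\boldsymbol f(\boldsymbol x)\in\mathbb R^{n\times p}$ be the matrix with $i$-th row $\nabla f^i(x^i)'$. The step-sizes are $\alpha_i>0$ and $D=\mathrm{diag}(\alpha_1,\dots,\alpha_n)$. Starting from arbitrary $\boldsymbol x_0\in\mathbb R^{n\times p}$ and $\boldsymbol y_0=\nabla\boldsymbol f(\boldsymbol x_0)$, for $k\ge0$, $$\boldsymbol x_{k+1}=W(\boldsymbol x_k-D\boldsymbol y_k),\qquad \boldsymbol y_{k+1}=W\left(\boldsymbol y_k+\nabla\boldsymbol f(\boldsymbol x_{k+1})-\nabla\boldsymbol f(\boldsymbol x_k)\right).$$ *)

(* Defs.v *)
From mathcomp Require Import all_boot all_order all_algebra.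
From mathcomp Require Import all_classical all_reals all_analysis.
Set Implicit Arguments.
Unset Strict Implicit.
Unset Printing Implicit Defensive.
Import Order.TTheory GRing.Theory Num.Theory.
Import numFieldNormedType.Exports.
Local Open Scope ring_scope.

(* Points of R^p are row vectors, so that the i-th row (x^i)' of the stacked
   matrix x : 'M[R]_(n, p) is literally [row i x]. There are n.+1 agents. *)

Section Euclidean.
Variable R : realType.

Definition frob_inner m n (A B : 'M[R]_(m, n)) : R := \tr (A^T *m B).

(* The library norm on matrices is the max norm, hence this one. *)
Definition frob_norm m n (A : 'M[R]_(m, n)) : R := Num.sqrt (frob_inner A A).

Definition J_mx n : 'M[R]_n := 1%:M - const_mx (n%:R^-1).

Definition J_seminorm n p (y : 'M[R]_(n, p)) : R :=
  Num.sqrt (frob_inner y (J_mx n *m y)).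

Definition maxf n (a : 'I_n.+1 -> R) : R := \big[Num.max/a ord0]_i a i.
Definition minf n (a : 'I_n.+1 -> R) : R := \big[Num.min/a ord0]_i a i.
Definition meanf n (a : 'I_n.+1 -> R) : R := n.+1%:R^-1 * \sum_i a i.

End Euclidean.

Section Objective.
Variables (R : realType) (p : nat).
Implicit Types g : 'rV[R]_p -> R.

Definition gradient g (x : 'rV[R]_p) : 'rV[R]_p :=
  \row_j 'D_(delta_mx 0 j) g x.

Definition smooth_with g (L : R) : Prop :=
  [/\ forall x, differentiable g x,
      0 < L
    & forall x y,
        frob_norm (gradient g x - gradient g y) <= L * frob_norm (x - y)].

(* mu = 0 (mere convexity) is allowed. *)
Definition strongly_convex_with g (mu : R) : Prop :=
  0 <= mu /\
  forall x y, g x >= g y + frob_inner (gradient g y) (x - y)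
                     + mu / 2 * frob_norm (x - y) ^+ 2.

Definition avg_objective n (f : 'I_n.+1 -> 'rV[R]_p -> R) (x : 'rV[R]_p) : R :=
  meanf (fun i => f i x).

Definition is_minimizer g (xs : 'rV[R]_p) : Prop := forall x, g xs <= g x.

Definition stacked_gradient n (f : 'I_n -> 'rV[R]_p -> R)
    (x : 'M[R]_(n, p)) : 'M[R]_(n, p) :=
  \matrix_i gradient (f i) (row i x).

End Objective.

Section Network.
Variables (R : realType) (n : nat).
Implicit Types (E : rel 'I_n) (W : 'M[R]_n).

(* Edges are a symmetric relation; loops are permitted, since compliance
   otherwise forces a zero diagonal in W. *)
Definition connected_graph E : Prop :=
  symmetric E /\ forall i j, connect E i j.

Definition doubly_stochastic W : Prop :=
  [/\ forall i j, 0 <= W i j,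
      forall i, \sum_j W i j = 1
    & forall j, \sum_i W i j = 1].

Definition compliant E W : Prop :=
  forall i j, (E j i -> 0 < W i j) /\ (~~ E j i -> W i j = 0).

Definition contraction_constant p W (delta : R) : Prop :=
  0 < delta < 1 /\
  forall y : 'M[R]_(n, p), J_seminorm (W *m y) <= delta * J_seminorm y.

End Network.

Section ATC_DIGing.
Variables (R : realType) (n p : nat).
Variables (f : 'I_n -> 'rV[R]_p -> R) (W : 'M[R]_n) (alpha : 'I_n -> R).

Definition step_size_mx : 'M[R]_n := diag_mx (\row_i alpha i).

Definition atc_diging_step (s : 'M[R]_(n, p) * 'M[R]_(n, p)) :
    'M[R]_(n, p) * 'M[R]_(n, p) :=
  let x' := W *m (s.1 - step_size_mx *m s.2) in
  (x', W *m (s.2 + stacked_gradient f x' - stacked_gradient f s.1)).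

(* The pair (x_k, y_k) started at (x0, grad f (x0)). *)
Definition atc_diging (x0 : 'M[R]_(n, p)) (k : nat) :
    'M[R]_(n, p) * 'M[R]_(n, p) :=
  iter k atc_diging_step (x0, stacked_gradient f x0).

End ATC_DIGing.

(* Main.v *)
Require Import Defs.
From mathcomp Require Import all_boot all_order all_algebra.
From mathcomp Require Import all_classical all_reals all_analysis.
From mathcomp Require Import ring lra.
Set Implicit Arguments.
Unset Strict Implicit.
Unset Printing Implicit Defensive.
Import Order.TTheory GRing.Theory Num.Theory.
Import numFieldNormedType.Exports.
Local Open Scope ring_scope.

(* Let [xb] be the mean of the rows of [x_k]. Gradient tracking keeps the mean of
   [y_k] equal to the mean of the local gradients, so [xb] performs an inexact
   gradient step of length [meanf alpha], perturbed by the disagreement of the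
   rows of [x_k] and, through the step-size heterogeneity, of those of [y_k].
   The three quantities [sqrt n * |xb - xs|], [J_seminorm x_k] and
   [J_seminorm y_k] thus satisfy a recursive system of inequalities, and the
   step-size condition provides positive constants [P], [X], [Y] such that the
   bounds [P c], [X c], [Y c] propagate to [P lam c], [X lam c], [Y lam c]. *)

(** * Frobenius inner product and norm *)

Section FrobeniusNorm.
Variables (R : realType) (m n : nat).
Implicit Types A B C : 'M[R]_(m, n).

Lemma frob_innerE A B : frob_inner A B = \sum_i \sum_j A i j * B i j.
Proof.
rewrite /frob_inner /mxtrace exchange_big; apply: eq_bigr => j _.
by rewrite mxE; apply: eq_bigr => i _; rewrite mxE.
Qed.

Lemma frob_innerC A B : frob_inner A B = frob_inner B A.
Proof.
by rewrite !frob_innerE; apply: eq_bigr => i _; apply: eq_bigr => j _; rewrite mulrC.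
Qed.

Lemma frob_innerDr A B C : frob_inner A (B + C) = frob_inner A B + frob_inner A C.
Proof. by rewrite /frob_inner mulmxDr mxtraceD. Qed.

Lemma frob_innerZr a A B : frob_inner A (a *: B) = a * frob_inner A B.
Proof. by rewrite /frob_inner -scalemxAr mxtraceZ. Qed.

Lemma frob_innerNr A B : frob_inner A (- B) = - frob_inner A B.
Proof. by rewrite -scaleN1r frob_innerZr mulN1r. Qed.

Lemma frob_innerDl A B C : frob_inner (A + B) C = frob_inner A C + frob_inner B C.
Proof. by rewrite !(frob_innerC _ C) frob_innerDr. Qed.

Lemma frob_innerZl a A B : frob_inner (a *: A) B = a * frob_inner A B.
Proof. by rewrite !(frob_innerC _ B) frob_innerZr. Qed.

Lemma frob_innerNl A B : frob_inner (- A) B = - frob_inner A B.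
Proof. by rewrite !(frob_innerC _ B) frob_innerNr. Qed.

Definition frob_inner_linE := (frob_innerDl, frob_innerDr, frob_innerNl, frob_innerNr,
  frob_innerZl, frob_innerZr).

Lemma frob_inner_suml (I : finType) (F : I -> 'M[R]_(m, n)) A :
  frob_inner (\sum_i F i) A = \sum_i frob_inner (F i) A.
Proof.
by rewrite /frob_inner linear_sum mulmx_suml raddf_sum.
Qed.

Lemma frob_inner_ge0 A : 0 <= frob_inner A A.
Proof. by rewrite frob_innerE; do 2 (apply: sumr_ge0 => ? _); rewrite -expr2 sqr_ge0. Qed.

Lemma frob_norm_ge0 A : 0 <= frob_norm A.
Proof. exact: sqrtr_ge0. Qed.

Lemma frob_norm_sqr A : frob_norm A ^+ 2 = frob_inner A A.
Proof. by rewrite sqr_sqrtr // frob_inner_ge0. Qed.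

Lemma frob_norm_eq0 A : (frob_norm A == 0) = (A == 0).
Proof.
apply/idP/eqP => [|->]; last by rewrite /frob_norm /frob_inner mulmx0 mxtrace0 sqrtr0.
rewrite -sqrf_eq0 frob_norm_sqr frob_innerE => /eqP A0.
have sq0 (x : R) : 0 <= x * x by rewrite -expr2 sqr_ge0.
apply/matrixP => i j; rewrite mxE; apply/eqP.
have Ai : \sum_k A i k * A i k = 0.
  by apply: (psumr_eq0P _ A0) => // k _; apply: sumr_ge0.
have : A i j * A i j = 0 by apply: (psumr_eq0P _ Ai).
by move/eqP; rewrite mulf_eq0 orbb.
Qed.

Lemma frob_normZ a A : frob_norm (a *: A) = `|a| * frob_norm A.
Proof.
by rewrite /frob_norm frob_innerZl frob_innerZr mulrA -expr2 sqrtrM ?sqr_ge0 // sqrtr_sqr.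
Qed.

Lemma frob_normN A : frob_norm (- A) = frob_norm A.
Proof. by rewrite -scaleN1r frob_normZ normrN1 mul1r. Qed.

(** Expanding the nonnegative square of [frob_norm B *: A - frob_norm A *: B] leaves
    [2 * frob_norm A * frob_norm B] times the difference of the two sides. *)
Lemma frob_cauchy_schwarz A B : frob_inner A B <= frob_norm A * frob_norm B.
Proof.
have [->|B0] := eqVneq B 0.
  by rewrite (_ : frob_inner A 0 = 0) ?mulr_ge0 ?frob_norm_ge0// /frob_inner mulmx0 mxtrace0.
have [->|A0] := eqVneq A 0.
  by rewrite frob_innerC (_ : frob_inner B 0 = 0) ?mulr_ge0 ?frob_norm_ge0//
    /frob_inner mulmx0 mxtrace0.
have a0 : 0 < frob_norm A by rewrite lt_def frob_norm_eq0 A0 frob_norm_ge0.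
have b0 : 0 < frob_norm B by rewrite lt_def frob_norm_eq0 B0 frob_norm_ge0.
have := frob_inner_ge0 (frob_norm B *: A - frob_norm A *: B).
rewrite !frob_inner_linE -!frob_norm_sqr (frob_innerC B A) => H.
rewrite -(ler_pM2l (mulr_gt0 a0 b0)); nra.
Qed.

Lemma ler_frob_normD A B : frob_norm (A + B) <= frob_norm A + frob_norm B.
Proof.
rewrite -(@ler_pXn2r _ 2) ?nnegrE ?addr_ge0 ?frob_norm_ge0//.
rewrite frob_norm_sqr !frob_inner_linE (frob_innerC B A) -!frob_norm_sqr.
have := frob_cauchy_schwarz A B; nra.
Qed.

Lemma ler_frob_normB A B : frob_norm (A - B) <= frob_norm A + frob_norm B.
Proof. by rewrite -(frob_normN B) ler_frob_normD. Qed.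

End FrobeniusNorm.

(** * Row-wise decomposition of the Frobenius norm *)

Section Rows.
Variables (R : realType) (m n : nat).
Implicit Types A B : 'M[R]_(m, n).

Lemma frob_inner_rows A B : frob_inner A B = \sum_i frob_inner (row i A) (row i B).
Proof.
rewrite frob_innerE; apply: eq_bigr => i _; rewrite frob_innerE big_ord1.
by apply: eq_bigr => j _; rewrite !mxE.
Qed.

Lemma frob_norm_rows A : frob_norm A ^+ 2 = \sum_i frob_norm (row i A) ^+ 2.
Proof. by rewrite frob_norm_sqr frob_inner_rows; apply: eq_bigr => i _; rewrite frob_norm_sqr. Qed.

(** Squared norms add up over the rows, so a common factor passes to the whole matrix. This serves
    both the stacked gradient and the diagonal step-size matrices. *)
Lemma ler_frob_norm_rows A c B : 0 <= c ->
  (forall i, frob_norm (row i A) <= c * frob_norm (row i B)) ->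
  frob_norm A <= c * frob_norm B.
Proof.
move=> c0 H; rewrite -(@ler_pXn2r _ 2) ?nnegrE ?mulr_ge0 ?frob_norm_ge0//.
rewrite exprMn !frob_norm_rows mulr_sumr; apply: ler_sum => i _.
by rewrite -exprMn ler_pXn2r ?nnegrE ?mulr_ge0 ?frob_norm_ge0.
Qed.

End Rows.

(** * Splitting a stacked matrix into its consensus part and its deviation *)

Section Consensus.
Variables (R : realType) (n p : nat).
Local Notation N := (n.+1%:R : R).
Implicit Types (x y : 'M[R]_(n.+1, p)) (c : 'rV[R]_p).

Definition row_mean x : 'rV[R]_p := N^-1 *: \sum_i row i x.
Definition consensus c : 'M[R]_(n.+1, p) := (const_mx 1 : 'cV[R]_n.+1) *m c.
Definition deviation x : 'M[R]_(n.+1, p) := J_mx R n.+1 *m x.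

Lemma agents_gt0 : 0 < N. Proof. exact: ltr0Sn. Qed.

Lemma agents_neq0 : N != 0. Proof. exact: lt0r_neq0 agents_gt0. Qed.

Lemma row_consensus c i : row i (consensus c) = c.
Proof.
by apply/rowP => j; rewrite !mxE big_ord1 !mxE mul1r (ord1 ord0) .
Qed.

Lemma row_deviation x i : row i (deviation x) = row i x - row_mean x.
Proof.
apply/rowP => j; rewrite /deviation mulmxBl mul1mx !mxE summxE mulr_sumr.
by congr (_ - _); apply: eq_bigr => k _; rewrite !mxE.
Qed.

Lemma deviationE x : deviation x = x - consensus (row_mean x).
Proof. by apply/row_matrixP => i; rewrite row_deviation raddfB /= row_consensus. Qed.

Lemma deviationD x y : deviation (x + y) = deviation x + deviation y.
Proof. exact: mulmxDr. Qed.

Lemma deviationB x y : deviation (x - y) = deviation x - deviation y.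
Proof. exact: mulmxBr. Qed.

Lemma deviationZ a x : deviation (a *: x) = a *: deviation x.
Proof. by rewrite /deviation scalemxAr. Qed.

Lemma row_meanD x y : row_mean (x + y) = row_mean x + row_mean y.
Proof.
rewrite /row_mean -scalerDr -big_split; congr (_ *: _).
by apply: eq_bigr => i _; rewrite raddfD.
Qed.

Lemma row_meanZ a x : row_mean (a *: x) = a *: row_mean x.
Proof.
rewrite /row_mean scalerA mulrC -scalerA; congr (_ *: _); rewrite scaler_sumr.
by apply: eq_bigr => i _; rewrite linearZ.
Qed.

Lemma row_meanB x y : row_mean (x - y) = row_mean x - row_mean y.
Proof. by rewrite row_meanD -scaleN1r row_meanZ scaleN1r. Qed.

Lemma row_mean_consensus c : row_mean (consensus c) = c.
Proof.
rewrite /row_mean (eq_bigr (fun _ => c)) => [|i _]; last by rewrite row_consensus.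
by rewrite sumr_const card_ord -[c *+ _]scaler_nat scalerA mulVf ?agents_neq0 ?scale1r.
Qed.

Lemma row_mean_deviation x : row_mean (deviation x) = 0.
Proof. by rewrite deviationE row_meanB row_mean_consensus subrr. Qed.

Lemma deviation_consensus c : deviation (consensus c) = 0.
Proof. by rewrite deviationE row_mean_consensus subrr. Qed.

Lemma sum_row_deviation x : \sum_i row i (deviation x) = 0.
Proof.
have /eqP := row_mean_deviation x.
by rewrite /row_mean scaler_eq0 invr_eq0 (negbTE agents_neq0) => /eqP.
Qed.

(** Pythagoras: the rows of [deviation x] sum to zero, so it is orthogonal to every consensus matrix
    and the cross terms vanish. *)
Lemma frob_norm_sub_consensus x c :
  frob_norm (x - consensus c) ^+ 2
  = N * frob_norm (row_mean x - c) ^+ 2 + frob_norm (deviation x) ^+ 2.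
Proof.
have -> : x - consensus c = deviation x + consensus (row_mean x - c).
  by apply/row_matrixP => i; rewrite !raddfD /= row_consensus row_deviation raddfN /=
    row_consensus addrA subrK.
rewrite !frob_norm_sqr !frob_inner_linE (frob_innerC (consensus _) (deviation x)).
have -> : frob_inner (deviation x) (consensus (row_mean x - c)) = 0.
  rewrite frob_inner_rows (eq_bigr (fun i => frob_inner (row i (deviation x)) (row_mean x - c))).
    rewrite -frob_inner_suml sum_row_deviation.
    by rewrite -[0](scale0r 0) frob_innerZl mul0r.
  by move=> i _; rewrite row_consensus.
have -> : frob_inner (consensus (row_mean x - c)) (consensus (row_mean x - c)) =
    N * frob_inner (row_mean x - c) (row_mean x - c).
  rewrite frob_inner_rows (eq_bigr (fun=> frob_inner (row_mean x - c) (row_mean x - c))).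
    by rewrite sumr_const card_ord mulr_natl.
  by move=> i _; rewrite row_consensus.
by rewrite !frob_inner_linE; ring.
Qed.

(** The consensus part of [x] is orthogonal to [deviation x], so only the deviation survives in the
    first argument of the inner product. The contraction property of [W] can then be read in the
    Frobenius norm. *)
Lemma J_seminormE x : J_seminorm x = frob_norm (deviation x).
Proof.
rewrite /J_seminorm /frob_norm -/(deviation x); congr Num.sqrt.
rewrite {1}(_ : x = deviation x + consensus (row_mean x)); last by rewrite deviationE subrK.
rewrite frob_innerDl -[RHS]addr0; congr (_ + _).
rewrite frob_innerC frob_inner_rows.
rewrite (eq_bigr (fun i => frob_inner (row i (deviation x)) (row_mean x))).
  by rewrite -frob_inner_suml sum_row_deviation -[0](scale0r 0) frob_innerZl mul0r.
by move=> i _; rewrite row_consensus.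
Qed.

Lemma consensus0 : consensus 0 = 0. Proof. exact: mulmx0. Qed.

Lemma frob_norm_mean_deviation x :
  frob_norm x ^+ 2 = N * frob_norm (row_mean x) ^+ 2 + frob_norm (deviation x) ^+ 2.
Proof. by have := frob_norm_sub_consensus x 0; rewrite consensus0 !subr0. Qed.

Lemma ler_frob_norm_deviation x : frob_norm (deviation x) <= frob_norm x.
Proof.
rewrite -(@ler_pXn2r _ 2) ?nnegrE ?frob_norm_ge0// (frob_norm_mean_deviation x).
by rewrite lerDr mulr_ge0 ?sqr_ge0 ?ler0n.
Qed.

Lemma ler_frob_norm_row_mean x : Num.sqrt N * frob_norm (row_mean x) <= frob_norm x.
Proof.
rewrite -(@ler_pXn2r _ 2) ?nnegrE ?mulr_ge0 ?sqrtr_ge0 ?frob_norm_ge0//.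
by rewrite exprMn sqr_sqrtr ?ler0n// (frob_norm_mean_deviation x) lerDl sqr_ge0.
Qed.

Lemma row_mean_mulmx (W : 'M[R]_n.+1) x :
  (forall j, \sum_i W i j = 1) -> row_mean (W *m x) = row_mean x.
Proof.
move=> W1; rewrite /row_mean; congr (_ *: _); apply/rowP => j; rewrite !summxE.
under eq_bigr do rewrite !mxE.
rewrite exchange_big /=; apply: eq_bigr => k _.
by rewrite -mulr_suml W1 mul1r mxE.
Qed.

Lemma row_step_size_mx (alpha : 'I_n.+1 -> R) x i :
  row i (step_size_mx alpha *m x) = alpha i *: row i x.
Proof. by apply/rowP => j; rewrite mul_diag_mx !mxE. Qed.

Lemma ler_frob_norm_step_size (alpha : 'I_n.+1 -> R) x b : 0 <= b ->
  (forall i, `|alpha i| <= b) ->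
  frob_norm (step_size_mx alpha *m x) <= b * frob_norm x.
Proof.
move=> b0 ab; apply: ler_frob_norm_rows => // i.
by rewrite row_step_size_mx frob_normZ ler_wpM2r ?frob_norm_ge0.
Qed.

End Consensus.

(** * Smoothness and convexity of a single local objective *)

Section ConvexSmooth.
Variables (R : realType) (p : nat).
Implicit Types (g : 'rV[R]_p -> R) (x y : 'rV[R]_p).

(** The two convexity inequalities between a pair of points are added and compared with
    Cauchy-Schwarz and the Lipschitz bound. The hypothesis [0 < p] makes the zero vector and the
    all-ones vector distinct. *)
Lemma strong_convexity_le_smoothness g L mu : (0 < p)%N ->
  smooth_with g L -> strongly_convex_with g mu -> mu <= L.
Proof.
move=> p_gt0 [_ _ gL] [_ gmu].
set x : 'rV[R]_p := 0; pose y : 'rV[R]_p := const_mx 1.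
have d_gt0 : 0 < frob_norm (x - y).
  rewrite lt_def frob_norm_ge0 frob_norm_eq0 andbT sub0r oppr_eq0.
  apply/eqP => /rowP /(_ (Ordinal p_gt0)); rewrite !mxE => /eqP.
  by rewrite oner_eq0.
have := gmu x y; have := gmu y x; have := gL x y.
have := frob_cauchy_schwarz (gradient g x - gradient g y) (x - y).
have -> : y - x = - (x - y) by rewrite opprB.
rewrite frob_normN frob_innerNr frob_innerDl frob_innerNl => cs lip ge1 ge2.
rewrite -(ler_pM2r d_gt0) -(ler_pM2r d_gt0).
have := ler_wpM2r (ltW d_gt0) lip; move: cs ge1 ge2; clear; lra.
Qed.

(* The sharp constant [L / 2] comes from telescoping the convexity inequality
   along a subdivision of the segment [x, y] into ever more pieces. *)
Lemma smooth_upper_bound g L mu x y :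
  smooth_with g L -> strongly_convex_with g mu ->
  g y <= g x + frob_inner (gradient g x) (y - x) + L / 2 * frob_norm (y - x) ^+ 2.
Proof.
move=> [_ L_gt0 gL] [mu_ge0 gmu]; set d := y - x.
(* The gradient at the i-th subdivision point differs from that at [x] by at most [L * i / m.+1]
   times the norm of [d]; summing i from 1 to j gives the factor [j * (j + 1) / 2]. *)
have subdivision (m j : nat) : g (x + (j%:R / m.+1%:R) *: d)
    <= g x + j%:R / m.+1%:R * frob_inner (gradient g x) d
       + L * frob_norm d ^+ 2 * (j%:R * (j%:R + 1) / 2 / m.+1%:R ^+ 2).
  have m_gt0 : 0 < m.+1%:R^-1 :> R by rewrite invr_gt0 ltr0Sn.
  rewrite -exprVn; set t := m.+1%:R^-1 in m_gt0 *.
  elim: j => [|j IHj]; first by rewrite !mul0r !mulr0 scale0r !addr0.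
  set z := x + (j.+1%:R * t) *: d.
  (* Convexity is based at the new point [z], so that it bounds [g z] from above by the previous
     value plus [t] times the slope at [z]. *)
  have := gmu (x + (j%:R * t) *: d) z.
  have -> : x + (j%:R * t) *: d - z = - (t *: d).
    rewrite /z opprD addrACA subrr add0r -scalerBl -mulrBl -natr1 opprD addrA subrr add0r.
    by rewrite mulN1r scaleNr.
  have := gL z x; have := frob_cauchy_schwarz (gradient g z - gradient g x) d.
  have -> : z - x = (j.+1%:R * t) *: d by rewrite /z addrC addKr.
  have jt_ge0 : 0 <= j.+1%:R * t by rewrite mulr_ge0 ?ler0n ?ltW.
  rewrite frob_normZ (ger0_norm jt_ge0) frob_innerNr frob_innerZr.
  rewrite frob_innerDl frob_innerNl -natr1.
  have := frob_norm_ge0 d; have : 0 <= j%:R :> R by rewrite ler0n.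
  have : 0 <= mu / 2 * frob_norm (- (t *: d)) ^+ 2.
    by rewrite mulr_ge0 ?sqr_ge0 ?divr_ge0.
  move: IHj; set gz := g z; set gj := g _.
  set i1 := frob_inner (gradient g z) d; set i0 := frob_inner (gradient g x) d.
  set D := frob_norm d; set lip := frob_norm (_ - _).
  move: (j%:R : R) => J IHj q_ge0 J_ge0 D_ge0 cs hlip hcvx.
  have i1_le : i1 <= i0 + L * (J + 1) * t * D ^+ 2.
    by have := le_trans cs (ler_wpM2r D_ge0 hlip); clear; lra.
  have ti1 : t * i1 <= t * (i0 + L * (J + 1) * t * D ^+ 2) by rewrite ler_pM2l.
  have gz_le : gz <= gj + t * i1 by move: hcvx q_ge0; clear; lra.
  by move: gz_le ti1 IHj; clear; lra.
rewrite leNgt; apply/negP => gy_gt.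
set B := (X in X < _) in gy_gt.
(* With more than [z] pieces, the excess over [B] left by the subdivision drops below the supposed
   gap [g y - B]. *)
pose z := L * frob_norm d ^+ 2 / 2 / (g y - B).
have gB : 0 < g y - B by rewrite subr_gt0.
have z_ge0 : 0 <= z.
  by rewrite divr_ge0 ?(ltW gB)// divr_ge0// mulr_ge0 ?sqr_ge0 ?(ltW L_gt0).
have := archi_boundP z_ge0; set m := Num.bound z => z_lt.
have m_gt0 : 0 < m.+1%:R :> R by rewrite ltr0Sn.
have := subdivision m m.+1; rewrite divff ?lt0r_neq0// scale1r mul1r.
rewrite [x + d]addrC subrK.
have -> : L * frob_norm d ^+ 2 * (m.+1%:R * (m.+1%:R + 1) / 2 / m.+1%:R ^+ 2)
    = L / 2 * frob_norm d ^+ 2 + L * frob_norm d ^+ 2 / 2 / m.+1%:R.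
  by field; rewrite lt0r_neq0.
rewrite addrA -/B -lerBlDl leNgt => /negP; apply.
rewrite ltr_pdivrMr// -ltr_pdivrMl// mulrC -/z.
by apply: (lt_le_trans z_lt); rewrite ler_nat.
Qed.

End ConvexSmooth.

(** * An inexact gradient step on the average objective *)

Section InexactGradient.
Variables (R : realType) (n p : nat).
Local Notation N := (n.+1%:R : R).
Variables (f : 'I_n.+1 -> 'rV[R]_p -> R) (Li mui : 'I_n.+1 -> R).
Variables (xs : 'rV[R]_p) (L : R).
Hypothesis hsmooth : forall i, smooth_with (f i) (Li i).
Hypothesis hconvex : forall i, strongly_convex_with (f i) (mui i).
Hypothesis hmin : is_minimizer (avg_objective f) xs.
Hypothesis hL : forall i, Li i <= L.
Hypothesis hmuL : forall i, mui i <= L.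

(* [avg_objective f u >= avg_objective f xs] at the new point [u], bounded above
   by smoothness and below by strong convexity around the individual rows. *)
Lemma inexact_gradient_step (x : 'M[R]_(n.+1, p)) a :
  0 <= a -> 2 * a * meanf Li <= 1 ->
  frob_norm (row_mean x - a *: row_mean (stacked_gradient f x) - xs) ^+ 2
  <= (1 - 4 / 5 * a * meanf mui) * frob_norm (row_mean x - xs) ^+ 2
     + 6 * a * L / N * frob_norm (deviation x) ^+ 2.
Proof.
move=> a_ge0 aL; set xb := row_mean x; set G := stacked_gradient f x.
set g := row_mean G; set u := xb - a *: g.
have rowG i : row i G = gradient (f i) (row i x) by rewrite rowK.
pose e i := frob_norm (row i (deviation x)) ^+ 2.
set A2 := frob_norm (xb - xs) ^+ 2; set g2 := frob_norm g ^+ 2.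
(* Smoothness from [row i x] to [u] is combined with strong convexity from [row i x] to [xs]. The
   constants come from the two Young inequalities below; [3 * L] bounds [Li i + 2 * mui i]. *)
have agent i : f i u - f i xs <= frob_inner (row i G) (u - xs)
    + (Li i * (a ^+ 2 * g2) - 2 / 5 * mui i * A2 + 3 * L * e i).
  have := smooth_upper_bound (row i x) u (hsmooth i) (hconvex i).
  have [mu_ge0 /(_ xs (row i x))] := hconvex i.
  have [_ L_gt0 _] := hsmooth i.
  rewrite -rowG; move: (row i G) => Gi lower upper.
  have -> : u - xs = (u - row i x) - (xs - row i x) by rewrite opprB addrA subrK.
  rewrite frob_innerDr frob_innerNr.
  have : frob_norm (u - row i x) ^+ 2 <= 2 * (a ^+ 2 * g2) + 2 * e i.
    have -> : u - row i x = - (a *: g + row i (deviation x)).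
      by rewrite row_deviation -/xb /u opprD opprB addrCA addrA addrAC.
    have := frob_inner_ge0 (a *: g - row i (deviation x)).
    rewrite /e /g2 !frob_norm_sqr; move: (row i _) (g) => w v.
    rewrite !frob_inner_linE (frob_innerC w v).
    move: (frob_inner g g) (frob_inner _ _) (frob_inner _ _) => ? ? ?; nra.
  (* Young's inequality with weight 5 keeps four fifths of the mean error at the price of
     [4 * e i]. *)
  have : 4 / 5 * A2 - 4 * e i <= frob_norm (xs - row i x) ^+ 2.
    have -> : xs - row i x = - (xb - xs + row i (deviation x)).
      by rewrite row_deviation -/xb opprD !opprB addrA subrK.
    have := frob_inner_ge0 (xb - xs + 5 *: row i (deviation x)).
    rewrite /e /A2 !frob_norm_sqr; move: (xb - xs) (row i _) => v w.
    rewrite !frob_inner_linE (frob_innerC w v).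
    move: (frob_inner v v) (frob_inner _ _) (frob_inner _ _) => ? ? ?; nra.
  have e_ge0 : 0 <= e i by rewrite sqr_ge0.
  have := ler_wpM2r e_ge0 (hL i); have := ler_wpM2r e_ge0 (hmuL i).
  move: lower upper; move: (frob_norm _ ^+ 2) (frob_norm _ ^+ 2) => V U lower upper muLe Le hV hU.
  have := ler_wpM2l mu_ge0 hV; have := ler_wpM2l (ltW L_gt0) hU; lra.
have := hmin u; rewrite -subr_ge0 /avg_objective /meanf -mulrBr -sumrB.
have N_gt0 : 0 < N^-1 by rewrite invr_gt0 agents_gt0.
have agents : \sum_i (f i u - f i xs) <= frob_inner (\sum_i row i G) (u - xs)
    + ((\sum_i Li i) * (a ^+ 2 * g2) - 2 / 5 * (\sum_i mui i) * A2
       + 3 * L * frob_norm (deviation x) ^+ 2).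
  rewrite frob_inner_suml frob_norm_rows !mulr_suml !mulr_sumr !mulr_suml -sumrB -!big_split.
  exact: ler_sum.
move=> /le_trans /(_ (ler_wpM2l (ltW N_gt0) agents)).
rewrite mulrDr -frob_innerZl -/(row_mean G) -/g /g2 => agents_avg.
move: agents_avg aL; have -> : u - xs = xb - xs - a *: g by rewrite /u addrAC.
rewrite /meanf /A2; move: (xb - xs) (g) => v w.
set q := frob_norm w ^+ 2; set B := frob_norm v ^+ 2.
rewrite [X in _ -> _ -> X <= _]frob_norm_sqr !frob_inner_linE (frob_innerC v w) -!frob_norm_sqr
  -/B -/q.
have q_ge0 : 0 <= q by exact: sqr_ge0.
move: (\sum_i Li i) (\sum_i mui i) (frob_inner w v) (frob_norm (deviation x) ^+ 2) N^-1
  => SL Sm i0 D K.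
move: q B q_ge0 => q B q_ge0 H aL.
have := ler_wpM2l a_ge0 H.
(* The restriction on [a] lets the negative term in the squared gradient absorb the smoothness
   term. *)
have : 2 * a * (K * SL) * (a * a * q) <= a * a * q.
  by rewrite ler_piMl// !mulr_ge0.
lra.
Qed.

(** A gradient step of length [1 / (2 * meanf Li)] from the consensus minimizer has both error terms
    of [inexact_gradient_step] equal to zero, so it does not move. *)
Lemma row_mean_gradient_minimizer :
  row_mean (stacked_gradient f (consensus n xs)) = 0.
Proof.
have Lbar_gt0 : 0 < meanf Li.
  rewrite /meanf mulr_gt0 ?invr_gt0 ?agents_gt0// big_ord_recl ltr_wpDr//.
    by apply: sumr_ge0 => i _; have [_ /ltW] := hsmooth (lift ord0 i).
  by have [] := hsmooth ord0.
set g := row_mean _; pose a := (2 * meanf Li)^-1.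
have a_gt0 : 0 < a by rewrite invr_gt0 mulr_gt0.
have := @inexact_gradient_step (consensus n xs) a (ltW a_gt0).
rewrite mulrAC mulfV ?lexx => [/(_ isT)|]; last by rewrite mulf_neq0 ?lt0r_neq0.
rewrite row_mean_consensus deviation_consensus subrr addrAC subrr add0r frob_normN frob_normZ.
have norm0 k l : frob_norm (0 : 'M[R]_(k, l)) = 0 by apply/eqP; rewrite frob_norm_eq0.
rewrite !norm0 expr0n !mulr0 addr0 => sq_le0; apply/eqP; rewrite -frob_norm_eq0.
have : (`|a| * frob_norm g) ^+ 2 == 0 by rewrite eq_le sqr_ge0 sq_le0.
by rewrite sqrf_eq0 mulf_eq0 normr_eq0 (gt_eqF a_gt0).
Qed.

End InexactGradient.

(** * Error recursions for one iteration of the algorithm *)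

Section StepBounds.
Variables (R : realType) (n p : nat).
Local Notation N := (n.+1%:R : R).

Lemma frob_norm_consensus (c : 'rV[R]_p) :
  frob_norm (consensus n c) = Num.sqrt N * frob_norm c.
Proof.
apply/eqP; rewrite -(@eqrXn2 _ 2) ?mulr_ge0 ?sqrtr_ge0 ?frob_norm_ge0//.
rewrite exprMn (sqr_sqrtr (ler0n R n.+1)) frob_norm_mean_deviation.
rewrite row_mean_consensus deviation_consensus.
have /eqP -> : frob_norm (0 : 'M[R]_(n.+1, p)) == 0 by rewrite frob_norm_eq0.
by rewrite expr0n addr0.
Qed.

Lemma step_size_mx_shift (alpha : 'I_n.+1 -> R) c (y : 'M[R]_(n.+1, p)) :
  step_size_mx alpha *m y = step_size_mx (fun i => alpha i - c) *m y + c *: y.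
Proof.
by apply/row_matrixP => i; rewrite raddfD /= !row_step_size_mx linearZ /= -scalerDl subrK.
Qed.

Lemma row_mean_step_size_consensus (alpha : 'I_n.+1 -> R) (c : 'rV[R]_p) :
  row_mean (step_size_mx alpha *m consensus n c) = meanf alpha *: c.
Proof.
rewrite /row_mean /meanf -scalerA scaler_suml; congr (_ *: _).
by apply: eq_bigr => i _; rewrite row_step_size_mx row_consensus.
Qed.

Variables (f : 'I_n.+1 -> 'rV[R]_p -> R) (Li mui : 'I_n.+1 -> R).
Variables (xs : 'rV[R]_p) (L : R) (W : 'M[R]_n.+1) (delta : R).
Variables (alpha : 'I_n.+1 -> R) (amin amax : R).
Hypothesis hsmooth : forall i, smooth_with (f i) (Li i).
Hypothesis hconvex : forall i, strongly_convex_with (f i) (mui i).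
Hypothesis hmin : is_minimizer (avg_objective f) xs.
Hypothesis hL : forall i, Li i <= L.
Hypothesis hmuL : forall i, mui i <= L.
Hypothesis hW : forall j, \sum_i W i j = 1.
Hypothesis hdelta : contraction_constant p W delta.
Hypothesis amin_gt0 : 0 < amin.
Hypothesis halpha : forall i, amin <= alpha i <= amax.

Local Notation sg := (stacked_gradient f).
Local Notation err x := (x - consensus n xs).

Let L_ge0 : 0 <= L.
Proof. by have [_ h _] := hsmooth ord0; exact: le_trans (ltW h) (hL ord0). Qed.

Let delta_gt0 : 0 < delta. Proof. by case: hdelta => /andP[]. Qed.

Let amax_ge0 : 0 <= amax.
Proof.
by have /andP[h1 h2] := halpha ord0; exact: le_trans (ltW amin_gt0) (le_trans h1 h2).
Qed.

Lemma stacked_gradient_lipschitz (x y : 'M[R]_(n.+1, p)) :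
  frob_norm (sg x - sg y) <= L * frob_norm (x - y).
Proof.
apply: ler_frob_norm_rows => // i; rewrite !raddfB /= !rowK.
have [_ _ lip] := hsmooth i; apply: le_trans (lip _ _) _.
by rewrite ler_wpM2r ?frob_norm_ge0.
Qed.

Lemma contraction_deviation (x : 'M[R]_(n.+1, p)) :
  frob_norm (deviation (W *m x)) <= delta * frob_norm (deviation x).
Proof. by rewrite -!J_seminormE; case: hdelta. Qed.

(** The mean gradient vanishes at the consensus minimizer, so it is controlled by the Lipschitz
    bound on the distance from there. *)
Lemma row_mean_gradient_bound (x : 'M[R]_(n.+1, p)) :
  Num.sqrt N * frob_norm (row_mean (sg x)) <= L * frob_norm (err x).
Proof.
have -> : row_mean (sg x) = row_mean (sg x - sg (consensus n xs)).
  by rewrite row_meanB (row_mean_gradient_minimizer hsmooth hconvex hmin hL hmuL) subr0.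
exact: le_trans (ler_frob_norm_row_mean _) (stacked_gradient_lipschitz _ _).
Qed.

Let mid := (amax + amin) / 2.

Let mid_bound i : `|alpha i - mid| <= (amax - amin) / 2.
Proof. by rewrite /mid ler_norml; have := halpha i; lra. Qed.

Let spread_ge0 : 0 <= (amax - amin) / 2.
Proof. by have := halpha ord0; lra. Qed.

Let alpha_bound i : `|alpha i| <= amax.
Proof. by rewrite ler_norml; have := halpha i; move: amin_gt0; lra. Qed.

(* Since [deviation] kills consensus vectors, the diagonal [D] acting on the
   consensus part of [y] may be recentred at the midpoint of its entries. *)
Lemma deviation_step_size (y : 'M[R]_(n.+1, p)) :
  frob_norm (deviation (step_size_mx alpha *m y))
  <= amax * frob_norm (deviation y)
     + (amax - amin) / 2 * (Num.sqrt N * frob_norm (row_mean y)).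
Proof.
have {1}-> : y = deviation y + consensus n (row_mean y) by rewrite deviationE subrK.
rewrite mulmxDr (step_size_mx_shift alpha mid (consensus _ _)) !deviationD.
rewrite deviationZ deviation_consensus scaler0 addr0 -frob_norm_consensus.
apply: le_trans (ler_frob_normD _ _) _; apply: lerD;
  exact: le_trans (ler_frob_norm_deviation _) (ler_frob_norm_step_size _ _ _).
Qed.

(** On the consensus part of [y] the diagonal averages exactly to [meanf alpha]. The deviation part
    has zero mean, so recentring at the midpoint leaves only half the spread as a factor. *)
Lemma row_mean_step_size (y : 'M[R]_(n.+1, p)) :
  Num.sqrt N * frob_norm (row_mean (step_size_mx alpha *m y) - meanf alpha *: row_mean y)
  <= (amax - amin) / 2 * frob_norm (deviation y).
Proof.
have {1}-> : y = deviation y + consensus n (row_mean y) by rewrite deviationE subrK.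
rewrite mulmxDr row_meanD row_mean_step_size_consensus addrK.
rewrite (step_size_mx_shift alpha mid) row_meanD row_meanZ row_mean_deviation scaler0 addr0.
exact: le_trans (ler_frob_norm_row_mean _) (ler_frob_norm_step_size _ _ _).
Qed.

Variables (x y : 'M[R]_(n.+1, p)).
Hypothesis tracking : row_mean y = row_mean (sg x).
Let s' := atc_diging_step f W alpha (x, y).

(** [W] preserves row means, and the old mean gradient cancels. *)
Lemma atc_diging_step_tracking : row_mean s'.2 = row_mean (sg s'.1).
Proof.
rewrite /= row_mean_mulmx// row_meanB row_meanD tracking.
by rewrite [row_mean (sg x) + _]addrC addrK.
Qed.

Lemma atc_diging_step_deviation_x :
  frob_norm (deviation s'.1)
  <= delta * (frob_norm (deviation x) + (amax * frob_norm (deviation y)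
     + (amax - amin) / 2 * (L * frob_norm (err x)))).
Proof.
apply: le_trans (contraction_deviation _) _; rewrite ler_pM2l// deviationB.
apply: le_trans (ler_frob_normB _ _) _; rewrite lerD2l.
apply: le_trans (deviation_step_size _) _; rewrite lerD2l.
by rewrite tracking ler_wpM2l ?row_mean_gradient_bound.
Qed.

(** On average the iteration is a gradient step of length [meanf alpha] plus a heterogeneity error.
    Stating the gradient part through an upper bound [b] keeps square roots out of later
    estimates. *)
Lemma atc_diging_step_mean_x b : 0 <= b -> 2 * meanf alpha * meanf Li <= 1 ->
  (1 - 4 / 5 * meanf alpha * meanf mui) * (N * frob_norm (row_mean x - xs) ^+ 2)
    + 6 * meanf alpha * L * frob_norm (deviation x) ^+ 2 <= b ^+ 2 ->
  Num.sqrt N * frob_norm (row_mean s'.1 - xs)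
  <= b + (amax - amin) / 2 * frob_norm (deviation y).
Proof.
move=> b_ge0 step_le b_bound.
have mean_ge0 : 0 <= meanf alpha.
  rewrite mulr_ge0 ?invr_ge0 ?ler0n//; apply: sumr_ge0 => i _.
  by have /andP[h1 _] := halpha i; exact: le_trans (ltW amin_gt0) h1.
have := inexact_gradient_step hsmooth hconvex hmin hL hmuL x mean_ge0 step_le.
rewrite -tracking /= row_mean_mulmx// row_meanB => inexact.
have -> : row_mean x - row_mean (step_size_mx alpha *m y) - xs
  = (row_mean x - meanf alpha *: row_mean y - xs)
    - (row_mean (step_size_mx alpha *m y) - meanf alpha *: row_mean y).
  by rewrite opprB [RHS]addrAC addrA subrK.
apply: le_trans (ler_wpM2l (sqrtr_ge0 _) (ler_frob_normB _ _)) _.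
rewrite mulrDr; apply: lerD; last exact: row_mean_step_size.
rewrite -(@ler_pXn2r _ 2) ?nnegrE ?mulr_ge0 ?sqrtr_ge0 ?frob_norm_ge0//.
apply: le_trans b_bound; rewrite exprMn (sqr_sqrtr (ler0n R n.+1)).
apply: le_trans (ler_wpM2l (ler0n _ _) inexact) _.
have N_neq0 := agents_neq0 R n; move: N => K in N_neq0 *.
by rewrite le_eqVlt; apply/orP; left; apply/eqP; field.
Qed.

(** The change of the gradients is controlled by the displacement of the iterate, split through
    [consensus n xs]. The new total error thus enters the bound. *)
Lemma atc_diging_step_deviation_y :
  frob_norm (deviation s'.2)
  <= delta * (frob_norm (deviation y) + L * (frob_norm (err s'.1) + frob_norm (err x))).
Proof.
apply: le_trans (contraction_deviation _) _; rewrite ler_pM2l//.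
rewrite -addrA deviationD; apply: le_trans (ler_frob_normD _ _) _; rewrite lerD2l.
apply: le_trans (ler_frob_norm_deviation _) _.
apply: le_trans (stacked_gradient_lipschitz _ _) _; rewrite ler_wpM2l//.
have -> : s'.1 - x = err s'.1 - err x by rewrite opprB addrA subrK.
exact: ler_frob_normB.
Qed.

End StepBounds.

(** * Choice of the majorizing constants *)

Section RateConstants.
Variable R : realType.

(* Componentwise majorants of (mean error, deviation of x, deviation of y),
   normalised so that the total error is [1 = P ^+ 2 + X ^+ 2]; one iteration
   maps them below [lam] times themselves. *)
Lemma rate_constants (L mu m a A d lam : R) :
  0 < mu <= L -> 0 < m -> m <= a <= A -> 0 < d -> d < lam < 1 ->
  4 * Num.sqrt 3 * (L / mu) * (1 - m / A) <= lam - d ->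
  10 * L * d * Num.sqrt (L / mu) * A
    <= (lam - d) * (lam - d - 4 * Num.sqrt 3 * (L / mu) * (1 - m / A)) ->
  1 - A * mu / 3 <= lam ^+ 2 -> A * mu <= 1 / 2 ->
  exists P X Y b : R,
    [/\ [/\ 0 < P, 0 < X, 0 < Y, 0 <= b & P ^+ 2 + X ^+ 2 = 1],
        d * (X + (A * Y + (A - m) / 2 * L)) <= lam * X,
        (1 - 4 / 5 * a * mu) * P ^+ 2 + 6 * a * L * X ^+ 2 <= b ^+ 2,
        b + (A - m) / 2 * Y <= lam * P
      & d * (Y + L * (lam + 1)) <= lam * Y].
Proof.
move=> /andP[mu_gt0 muL] m_gt0 /andP[ma aA] d_gt0 /andP[d_lam lam1].
have A_gt0 : 0 < A by exact: lt_le_trans m_gt0 (le_trans ma aA).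
have L_gt0 : 0 < L by exact: lt_le_trans muL.
set u := lam - d; have u_gt0 : 0 < u by rewrite subr_gt0.
set kb := L / mu; set h := 1 - m / A.
have Am : A - m = A * h by rewrite /h; field; rewrite lt0r_neq0.
have h_ge0 : 0 <= h by rewrite subr_ge0 ler_pdivrMr ?mul1r// (le_trans ma).
have kb_ge1 : 1 <= kb by rewrite /kb ler_pdivlMr ?mul1r.
have Lkb : L = mu * kb by rewrite /kb; field; rewrite lt0r_neq0.
have w_ge : 69 / 40 <= Num.sqrt 3 :> R.
  by rewrite -(@ler_pXn2r _ 2) ?nnegrE ?sqrtr_ge0// ?sqr_sqrtr//; lra.
set k := Num.sqrt kb; have k_ge0 : 0 <= k := sqrtr_ge0 _.
have kk : k ^+ 2 = kb by rewrite sqr_sqrtr// (le_trans ler01).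
have k_gt0 : 0 < k by rewrite sqrtr_gt0 (lt_le_trans ltr01).
set s := A * mu; move: w_ge; set w := Num.sqrt 3 => w_ge H1 H2 H3 s_le.
have s_gt0 : 0 < s by rewrite mulr_gt0.
(* [r] is the share of the slack [u] consumed by the heterogeneity; what is left,
   [t], controls [X], and the mean error sees only a convex combination of both. *)
pose r := 4 * w * kb * h / u; pose t := 1 - r.
have ru : r * u = 4 * w * kb * h by rewrite /r divfK ?lt0r_neq0.
have kb_ge0 : 0 <= kb by exact: le_trans kb_ge1.
have kh_ge0 : 0 <= kb * h by rewrite mulr_ge0.
have w_ge0 : 0 <= w by exact: sqrtr_ge0.
have r_ge0 : 0 <= r by apply: divr_ge0; [do 3 apply: mulr_ge0 => //|exact: ltW].
have t_ge0 : 0 <= t by rewrite /t /r subr_ge0 ler_pdivrMr// mul1r.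
have khr : 69 / 10 * (kb * h) <= r * u.
  by have := ler_wpM2r kh_ge0 w_ge; rewrite ru; lra.
have u_le1 : u <= 1 by rewrite /u; lra.
have r_le1 : r <= 1 by rewrite -subr_ge0.
(* Here [69 / 10 * (kb * h) <= r * u <= 1] and [kb >= 1]; consequently the mean step is at least
   17/20 of [A]. *)
have h_le : h <= 3 / 20.
  have ru_le1 : r * u <= 1 by rewrite mulr_ile1// ltW.
  have := ler_wpM2r h_ge0 kb_ge1; lra.
have h_le1 : h <= 1 by lra.
have a_ge : 17 / 20 * A <= a.
  by have := ler_wpM2l (ltW A_gt0) h_le; rewrite -Am; lra.
have dlam_le2 : d * (1 + lam) <= 2.
  by have := @mulr_ile1 _ d lam; lra.
have gain_le2 : d * (1 + lam) + h * u / 2 <= 2.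
  have : h * u <= 1 * u by rewrite ler_pM2r.
  have : d * lam <= 1 * lam by rewrite ler_wpM2r; lra.
  by rewrite /u; lra.
have gain_gt0 : 0 < d * (1 + lam) + h * u / 2.
  have : 0 <= h * u by rewrite mulr_ge0 ?(ltW u_gt0).
  have : 0 < d * lam by rewrite mulr_gt0// (lt_trans d_gt0).
  lra.
(* [Y] and then [X] solve their own recursions with equality; [P] is later fixed by the
   normalisation. *)
pose Y := d * L * (1 + lam) / u.
pose X := d * A * L * (d * (1 + lam) + h * u / 2) / u ^+ 2.
have Yu : Y * u = d * L * (1 + lam) by rewrite /Y divfK ?lt0r_neq0.
have Xu : X * u ^+ 2 = d * A * L * (d * (1 + lam) + h * u / 2).
  by rewrite /X divfK ?expf_neq0 ?lt0r_neq0.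
have lam1_gt0 : 0 < 1 + lam by rewrite addr_gt0// (lt_trans d_gt0).
have Y_gt0 : 0 < Y by rewrite divr_gt0// !mulr_gt0.
have X_gt0 : 0 < X by rewrite divr_gt0 ?exprn_gt0// !mulr_gt0.
have X_le : 5 * k * X <= t.
  rewrite -(ler_pM2r (exprn_gt0 2 u_gt0)) -[5 * k * X * _]mulrA Xu.
  have -> : t * u ^+ 2 = u * (u - 4 * w * kb * h) by rewrite -ru /t; ring.
  apply: le_trans H2.
  have dAL_ge0 : 0 <= k * (d * A * L) by rewrite ltW// !mulr_gt0.
  by have := ler_wpM2l dAL_ge0 gain_le2; lra.
have kbX : 25 * (kb * X ^+ 2) <= t.
  have t_le1 : t <= 1 by rewrite /t; lra.
  have kX_ge0 : 0 <= 5 * k * X by apply: mulr_ge0 (ltW X_gt0); apply: mulr_ge0.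
  have : (5 * k * X) * (5 * k * X) <= t * 1 by apply: ler_pM; rewrite // (le_trans X_le).
  by rewrite -kk; lra.
have X2_le : X ^+ 2 <= 1 / 25.
  have := ler_wpM2r (sqr_ge0 X) kb_ge1; move: kbX r_ge0; rewrite /t; lra.
pose P := Num.sqrt (1 - X ^+ 2).
have P2 : P ^+ 2 = 1 - X ^+ 2 by rewrite sqr_sqrtr//; lra.
have P_ge : 97 / 100 <= P.
  by rewrite -(@ler_pXn2r _ 2) ?nnegrE ?sqrtr_ge0// ?P2; lra.
have P_gt0 : 0 < P by apply: lt_le_trans P_ge; rewrite divr_gt0.
have st_ge0 : 0 <= s * t by rewrite mulr_ge0 ?(ltW s_gt0).
have sr_ge0 : 0 <= s * r by rewrite mulr_ge0 ?(ltW s_gt0).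
(* Half of the net decrease of the squared mean error: 17/50 is half of [4 / 5 * (17 / 20)], and 1/8
   is half of the 1/4 in [h3]. Since [1 - 2 * z <= (1 - z) ^+ 2], the choice [b = (1 - z) * P]
   avoids a root. *)
pose z := 17 / 50 * s - 1 / 8 * (s * t).
have z_le : z <= 1 by rewrite /z; lra.
exists P, X, Y, ((1 - z) * P); split.
- by split; rewrite ?mulr_ge0 ?(ltW P_gt0)// ?subr_ge0// P2 subrK.
- rewrite -subr_ge0 -(pmulr_lge0 _ u_gt0) le_eqVlt; apply/orP; left; apply/eqP.
  rewrite Am.
  have -> : (lam * X - d * (X + (A * Y + A * h / 2 * L))) * u
     = X * u ^+ 2 - d * A * (Y * u) - d * A * h / 2 * L * u by rewrite /u; ring.
  by rewrite Xu Yu; ring.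
- have sq_le : 24 / 25 <= P ^+ 2 by rewrite P2; lra.
  have h1 : 17 / 25 * s * P ^+ 2 <= 4 / 5 * a * mu * P ^+ 2.
    rewrite ler_wpM2r ?sqr_ge0//.
    by have := ler_wpM2r (ltW mu_gt0) a_ge; rewrite /s; lra.
  have h2 : 6 * a * L * X ^+ 2 <= 6 / 25 * (s * t).
    have hA : a * (L * X ^+ 2) <= A * (L * X ^+ 2).
      by rewrite ler_wpM2r// mulr_ge0 ?sqr_ge0 ?(ltW L_gt0).
    have := ler_wpM2l (ltW s_gt0) kbX.
    have : s * (kb * X ^+ 2) = A * (L * X ^+ 2) by rewrite Lkb /s; ring.
    lra.
  have h3 : 6 / 25 * (s * t) <= 1 / 4 * (s * t) * P ^+ 2.
    by have := ler_wpM2l st_ge0 sq_le; lra.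
  have : (1 - 2 * z) * P ^+ 2 <= ((1 - z) * P) ^+ 2.
    by rewrite exprMn ler_wpM2r ?sqr_ge0//; have := sqr_ge0 z; lra.
  by rewrite /z; lra.
- have Y_le : A * h / 2 * Y <= 3 / 20 * (s * r) * P.
    have -> : A * h / 2 * Y = A * h * L * (d * (1 + lam)) / 2 / u by rewrite /Y; ring.
    rewrite ler_pdivrMr//.
    have AhL_ge0 : 0 <= A * h * L by rewrite !mulr_ge0// ltW.
    have := ler_wpM2l AhL_ge0 dlam_le2.
    have := ler_wpM2l (ltW s_gt0) khr.
    have -> : s * (69 / 10 * (kb * h)) = 69 / 10 * (A * h * L) by rewrite Lkb /s; ring.
    have := ler_wpM2l (mulr_ge0 sr_ge0 (ltW u_gt0)) P_ge.
    lra.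
  (* A linear minorant of the square root of [1 - s / 3] for [s <= 1 / 2]. As [r + t = 1], the
     losses [3 / 20 * (s * r)] and [1 / 8 * (s * t)] total at most [3 / 20 * s], and 17/50 - 3/20 =
     19/100. *)
  have lam_ge : 1 - 19 / 100 * s <= lam.
    rewrite leNgt; apply/negP => lt_lam.
    have : lam ^+ 2 < (1 - 19 / 100 * s) ^+ 2.
      by rewrite ltr_pXn2r ?nnegrE//; lra.
    have : s * s <= s * (1 / 2) by rewrite ler_pM2l.
    lra.
  have : (1 - 19 / 100 * s) * P <= lam * P by rewrite ler_pM2r.
  have stP : 0 <= s * t * P by rewrite mulr_ge0// ltW.
  have -> : (1 - z) * P = (1 - 17 / 50 * s + 1 / 8 * (s * t)) * P by rewrite /z; ring.
  have : s * r * P = s * P - s * t * P by rewrite /t; ring.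
  by rewrite Am; lra.
- rewrite -subr_ge0.
  have -> : lam * Y - d * (Y + L * (lam + 1)) = Y * u - d * L * (1 + lam) by rewrite /u; ring.
  by rewrite Yu subrr.
Qed.
End RateConstants.

(** * Propagation of the bounds along the iteration *)

Section GeometricDecay.
Variables (R : realType) (n p : nat).
Local Notation N := (n.+1%:R : R).
Variables (f : 'I_n.+1 -> 'rV[R]_p -> R) (Li mui : 'I_n.+1 -> R).
Variables (xs : 'rV[R]_p) (L : R) (W : 'M[R]_n.+1) (delta : R).
Variables (alpha : 'I_n.+1 -> R) (amin amax lam P X Y b : R).
Hypothesis hsmooth : forall i, smooth_with (f i) (Li i).
Hypothesis hconvex : forall i, strongly_convex_with (f i) (mui i).
Hypothesis hmin : is_minimizer (avg_objective f) xs.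
Hypothesis hL : forall i, Li i <= L.
Hypothesis hmuL : forall i, mui i <= L.
Hypothesis hW : forall j, \sum_i W i j = 1.
Hypothesis hdelta : contraction_constant p W delta.
Hypothesis amin_gt0 : 0 < amin.
Hypothesis halpha : forall i, amin <= alpha i <= amax.
Hypothesis step_le : 2 * meanf alpha * meanf Li <= 1.
Hypothesis lam_gt0 : 0 < lam.
Hypothesis P_gt0 : 0 < P.
Hypothesis X_gt0 : 0 < X.
Hypothesis Y_gt0 : 0 < Y.
Hypothesis b_ge0 : 0 <= b.
Hypothesis PX : P ^+ 2 + X ^+ 2 = 1.
Hypothesis rate_x : delta * (X + (amax * Y + (amax - amin) / 2 * L)) <= lam * X.
Hypothesis rate_b : (1 - 4 / 5 * meanf alpha * meanf mui) * P ^+ 2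
  + 6 * meanf alpha * L * X ^+ 2 <= b ^+ 2.
Hypothesis rate_mean : b + (amax - amin) / 2 * Y <= lam * P.
Hypothesis rate_y : delta * (Y + L * (lam + 1)) <= lam * Y.
Hypothesis contraction : 0 <= 1 - 4 / 5 * meanf alpha * meanf mui.

(** The induction invariant; it carries the tracking identity because the step bounds rely on it. *)
Definition majorized (c : R) (s : 'M[R]_(n.+1, p) * 'M[R]_(n.+1, p)) : Prop :=
  [/\ row_mean s.2 = row_mean (stacked_gradient f s.1),
      Num.sqrt N * frob_norm (row_mean s.1 - xs) <= P * c,
      frob_norm (deviation s.1) <= X * c
    & frob_norm (deviation s.2) <= Y * c].

(** Pythagoras together with [PX]: the mean and deviation bounds recombine to exactly [c]. *)
Lemma error_le c (x : 'M[R]_(n.+1, p)) : 0 <= c ->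
  Num.sqrt N * frob_norm (row_mean x - xs) <= P * c ->
  frob_norm (deviation x) <= X * c -> frob_norm (x - consensus n xs) <= c.
Proof.
move=> c_ge0 hP hX.
rewrite -(@ler_pXn2r _ 2) ?nnegrE ?frob_norm_ge0// frob_norm_sub_consensus.
have -> : c ^+ 2 = P ^+ 2 * c ^+ 2 + X ^+ 2 * c ^+ 2 by rewrite -mulrDl PX mul1r.
rewrite -!exprMn.
apply: lerD; last by apply: lerXn2r; rewrite ?nnegrE ?frob_norm_ge0 ?mulr_ge0// ltW.
rewrite -[Z in Z * _](sqr_sqrtr (ler0n R n.+1)) -exprMn.
by apply: lerXn2r; rewrite ?nnegrE ?mulr_ge0 ?sqrtr_ge0 ?frob_norm_ge0// ltW.
Qed.

(** The step bounds are homogeneous in [c]. The two bounds on the new [x] come first, because the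
    one on the new [y] needs the new total error to be at most [lam * c]. *)
Lemma majorized_step c s : 0 <= c -> majorized c s ->
  majorized (lam * c) (atc_diging_step f W alpha s).
Proof.
case: s => x y c_ge0 maj; have [tracking hP hX hY] := maj.
have err_le := error_le c_ge0 hP hX; move: tracking hP hX hY err_le => /= tracking hP hX hY err_le.
have delta_gt0 : 0 < delta by case: hdelta => /andP[].
have L_ge0 : 0 <= L by have [_ h _] := hsmooth ord0; exact: le_trans (ltW h) (hL ord0).
have amin_le : amin <= amax by have /andP[h1 h2] := halpha ord0; exact: le_trans h1 h2.
have amax_ge0 : 0 <= amax := le_trans (ltW amin_gt0) amin_le.
have spread_ge0 : 0 <= (amax - amin) / 2 by rewrite divr_ge0 ?subr_ge0.
have mean_ge0 : 0 <= meanf alpha.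
  rewrite mulr_ge0 ?invr_ge0 ?ler0n//; apply: sumr_ge0 => i _.
  by have /andP[h1 _] := halpha i; exact: le_trans (ltW amin_gt0) h1.
set s' := atc_diging_step _ _ _ _.
have mean' : Num.sqrt N * frob_norm (row_mean s'.1 - xs) <= P * (lam * c).
  have bc_ge0 : 0 <= b * c by rewrite mulr_ge0.
  apply: le_trans (atc_diging_step_mean_x hsmooth hconvex hmin hL hmuL hW amin_gt0 halpha
    tracking bc_ge0 step_le _) _.
    apply: (@le_trans _ _ (((1 - 4 / 5 * meanf alpha * meanf mui) * P ^+ 2
      + 6 * meanf alpha * L * X ^+ 2) * c ^+ 2)).
      have hP2 : N * frob_norm (row_mean x - xs) ^+ 2 <= P ^+ 2 * c ^+ 2.
        rewrite -[Z in Z * _](sqr_sqrtr (ler0n R n.+1)) -!exprMn.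
        by apply: lerXn2r; rewrite ?nnegrE ?mulr_ge0 ?sqrtr_ge0 ?frob_norm_ge0// ltW.
      have hX2 : frob_norm (deviation x) ^+ 2 <= X ^+ 2 * c ^+ 2.
        by rewrite -exprMn; apply: lerXn2r; rewrite ?nnegrE ?frob_norm_ge0 ?mulr_ge0// ltW.
      rewrite [leRHS]mulrDl -[_ * P ^+ 2 * _]mulrA -[_ * X ^+ 2 * _]mulrA.
      by apply: lerD; apply: ler_wpM2l => //; do 2 apply: mulr_ge0 => //.
    by rewrite exprMn ler_wpM2r ?sqr_ge0.
  have := ler_wpM2r c_ge0 rate_mean; have := ler_wpM2l spread_ge0 hY; lra.
have dev_x' : frob_norm (deviation s'.1) <= X * (lam * c).
  apply: le_trans (atc_diging_step_deviation_x hsmooth hconvex hmin hL hmuL hdelta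
    amin_gt0 halpha tracking) _.
  have := ler_wpM2r c_ge0 rate_x; rewrite -[delta * _ * c]mulrA => h.
  apply: le_trans (le_trans _ h) _; last by rewrite le_eqVlt; apply/orP; left; apply/eqP; ring.
  rewrite ler_pM2l//.
  have := ler_wpM2l amax_ge0 hY; have := ler_wpM2l spread_ge0 (ler_wpM2l L_ge0 err_le).
  move: hX; lra.
split=> //.
- exact: atc_diging_step_tracking.
- apply: le_trans (atc_diging_step_deviation_y xs alpha hsmooth hL hdelta x y) _.
  have err'_le : frob_norm (s'.1 - consensus n xs) <= lam * c.
    by apply: error_le; rewrite // mulr_ge0// ltW.
  have := ler_wpM2r c_ge0 rate_y; rewrite -[delta * _ * c]mulrA => h.
  apply: le_trans (le_trans _ h) _; last by rewrite le_eqVlt; apply/orP; left; apply/eqP; ring.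
  rewrite ler_pM2l//.
  have := ler_wpM2l L_ge0 (lerD err'_le err_le).
  move: hY; lra.
Qed.

Lemma atc_diging_decay (x0 : 'M[R]_(n.+1, p)) : exists C : R, 0 < C /\
  forall k, frob_norm ((atc_diging f W alpha x0 k).1 - consensus n xs) <= C * lam ^+ k.
Proof.
pose y0 := stacked_gradient f x0.
pose e1 := Num.sqrt N * frob_norm (row_mean x0 - xs).
(* Each initial error divided by its constant is at most [C], which starts the induction; the final
   1 makes [C] positive. *)
pose C := e1 / P + frob_norm (deviation x0) / X + frob_norm (deviation y0) / Y + 1.
have e1P : 0 <= e1 / P by rewrite divr_ge0 ?mulr_ge0 ?sqrtr_ge0 ?frob_norm_ge0 ?(ltW P_gt0).
have e2X : 0 <= frob_norm (deviation x0) / X by rewrite divr_ge0 ?frob_norm_ge0 ?(ltW X_gt0).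
have e3Y : 0 <= frob_norm (deviation y0) / Y by rewrite divr_ge0 ?frob_norm_ge0 ?(ltW Y_gt0).
have C_gt0 : 0 < C by rewrite /C; lra.
exists C; split=> // k.
have Ck_ge0 : 0 <= C * lam ^+ k
  by rewrite mulr_ge0 ?exprn_ge0 ?(ltW C_gt0) ?(ltW lam_gt0).
suff [_ hP hX _] : majorized (C * lam ^+ k) (atc_diging f W alpha x0 k).
  exact: error_le.
elim: k {Ck_ge0} => [|k IHk].
  rewrite expr0 mulr1 /atc_diging /=; split=> //=.
  - by rewrite [P * C]mulrC -ler_pdivrMr// -/e1 /C; lra.
  - by rewrite mulrC -ler_pdivrMr// /C; lra.
  - by rewrite mulrC -ler_pdivrMr// -/y0 /C; lra.
rewrite exprS mulrCA /atc_diging iterS; apply: majorized_step => //.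
by rewrite mulr_ge0 ?exprn_ge0 ?(ltW C_gt0) ?(ltW lam_gt0).
Qed.

End GeometricDecay.

(** * Maximum, minimum and mean over the agents *)

Section Extrema.
Variables (R : realType) (n : nat).
Implicit Types a b : 'I_n.+1 -> R.

Lemma le_maxf a i : a i <= maxf a.
Proof. exact: le_bigmax. Qed.

Lemma minf_le a i : minf a <= a i.
Proof. exact: bigmin_le. Qed.

Lemma minf_gt0 a : (forall i, 0 < a i) -> 0 < minf a.
Proof. by move=> a_gt0; rewrite /minf; elim/big_ind: _ => // x y; rewrite lt_min => -> ->. Qed.

Lemma meanf_cst (c : R) : meanf (fun _ : 'I_n.+1 => c) = c.
Proof.
by rewrite /meanf sumr_const card_ord -[c *+ _]mulr_natl mulKf ?pnatr_eq0.
Qed.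

Lemma ler_meanf a b : (forall i, a i <= b i) -> meanf a <= meanf b.
Proof. by move=> ab; rewrite ler_wpM2l ?invr_ge0 ?ler0n//; apply: ler_sum. Qed.

Lemma meanf_gt0 a : (forall i, 0 <= a i) -> (exists i, a i != 0) -> 0 < meanf a.
Proof.
move=> a_ge0 [i ai]; rewrite mulr_gt0 ?invr_gt0 ?ltr0n// (bigD1 i)//=.
by rewrite ltr_pwDl ?sumr_ge0// lt_def ai a_ge0.
Qed.

End Extrema.

(** * From the step-size conditions to the rate *)

Theorem theorem2 (R : realType) (n p : nat)
    (f : 'I_n.+1 -> 'rV[R]_p -> R) (Li mui : 'I_n.+1 -> R) (xs : 'rV[R]_p)
    (E : rel 'I_n.+1) (W : 'M[R]_n.+1) (delta : R)
    (alpha : 'I_n.+1 -> R) (x0 : 'M[R]_(n.+1, p))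
    (hsmooth : forall i, smooth_with (f i) (Li i))
    (hconvex : forall i, strongly_convex_with (f i) (mui i))
    (hmu : exists i, mui i != 0)
    (hmin : is_minimizer (avg_objective f) xs)
    (hE : connected_graph E)
    (hW : doubly_stochastic W)
    (hEW : compliant E W)
    (hdelta : contraction_constant p W delta)
    (halpha : forall i, 0 < alpha i) :
  let L := maxf Li in
  let Lbar := meanf Li in
  let mubar := meanf mui in
  let kbar := L / mubar in
  let amax := maxf alpha in
  let kD := amax / minf alpha in
  let sqrtn := Num.sqrt n.+1%:R in
  let lambda :=
    Num.max
      (Num.sqrt (12 * kbar ^+ 2 * (1 - kD^-1) ^+ 2
                 + 10 * L * delta * sqrtn * Num.sqrt kbar * amax)
       + delta + 2 * Num.sqrt 3 * kbar * (1 - kD^-1))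
      (Num.sqrt (1 - amax * mubar / 3)) in
  0 < amax
    < Num.min
        ((1 - delta) * (1 - delta - 4 * Num.sqrt 3 * kbar * (1 - kD^-1))
         / (10 * L * delta * sqrtn * Num.sqrt kbar))
        (1 / (2 * Lbar)) ->
  kD < 1 + (lambda - delta) / (4 * Num.sqrt 3 * kbar) ->
  0 < lambda < 1 /\
  exists C : R, 0 < C /\
    forall k : nat,
      frob_norm ((atc_diging f W alpha x0 k).1
                 - (const_mx 1 : 'cV[R]_n.+1) *m xs) <= C * lambda ^+ k.
Proof.
move=> L Lbar mubar kbar amax kD sqrtn lambda /andP[amax_gt0].
rewrite lt_min => /andP[amax_lt amax_Lbar] _.
have L_gt0 : 0 < L by have [_ h _] := hsmooth ord0; exact: lt_le_trans h (le_maxf _ _).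
have mubar_gt0 : 0 < mubar by apply: meanf_gt0 => // i; have [] := hconvex i.
have kbar_gt0 : 0 < kbar by rewrite divr_gt0.
have amin_gt0 := minf_gt0 halpha.
have [/andP[delta_gt0 delta_lt1] _] := hdelta.
have minf_amax : minf alpha <= amax := le_trans (minf_le _ ord0) (le_maxf _ ord0).
have kDV : kD^-1 = minf alpha / amax by rewrite /kD invf_div.
set h := 1 - kD^-1; have h_ge0 : 0 <= h.
  by rewrite /h kDV subr_ge0 ler_pdivrMr// mul1r.
set w := Num.sqrt 3 in amax_lt lambda *.
set g := 10 * L * delta * sqrtn * Num.sqrt kbar in amax_lt lambda *.
have sqrtn_gt0 : 0 < sqrtn by rewrite sqrtr_gt0 ltr0n.
have sqrtn_ge1 : 1 <= sqrtn.
  by rewrite -[1]sqrtr1 ler_sqrt ?ltr01 ?ler1n.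
have w_ge0 : 0 <= w := sqrtr_ge0 _.
have sk_gt0 : 0 < Num.sqrt kbar by rewrite sqrtr_gt0.
have g_gt0 : 0 < g.
  by apply: mulr_gt0 sk_gt0; apply: mulr_gt0 sqrtn_gt0; apply: mulr_gt0 delta_gt0; apply: mulr_gt0.
(* As 12 is the square of [2 * w], the first branch of [lambda] becomes [q + delta + c] with
   [q ^+ 2 = c ^+ 2 + g * amax]. *)
pose c := 2 * w * kbar * h.
have c_ge0 : 0 <= c by apply: mulr_ge0 h_ge0; apply: mulr_ge0 (ltW kbar_gt0); apply: mulr_ge0.
have cc : 12 * kbar ^+ 2 * (1 - kD^-1) ^+ 2 = c ^+ 2.
  have w2 : w ^+ 2 = 3 by rewrite sqr_sqrtr.
  by rewrite -/h /c !exprMn w2; ring.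
have gA_gt0 : 0 < g * amax by rewrite mulr_gt0.
set q := Num.sqrt (12 * kbar ^+ 2 * (1 - kD^-1) ^+ 2 + g * amax) in lambda *.
have q_ge0 : 0 <= q := sqrtr_ge0 _.
have q2 : q ^+ 2 = c ^+ 2 + g * amax.
  by rewrite sqr_sqrtr cc// addr_ge0 ?sqr_ge0// ltW.
have q_gt0 : 0 < q by rewrite sqrtr_gt0 cc ltr_wpDl ?sqr_ge0.
rewrite ltr_pdivlMr// in amax_lt.
have c4 : 4 * w * kbar * (1 - kD^-1) = 2 * c by rewrite /c -/h; ring.
rewrite c4 in amax_lt.
have gap_gt0 : 0 < 1 - delta - 2 * c.
  have : 0 < (1 - delta) * (1 - delta - 2 * c).
    by apply: lt_trans amax_lt; rewrite mulr_gt0.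
  by rewrite pmulr_rgt0// subr_gt0.
(* Squaring gives back the step-size condition, because [(1 - delta - c) ^+ 2 - c ^+ 2 = (1 - delta)
   * (1 - delta - 2 * c)]. *)
have q_lt : q < 1 - delta - c.
  rewrite -(@ltr_pXn2r _ 2) ?nnegrE//; last by lra.
  by rewrite q2; lra.
have lam_ge : q + delta + c <= lambda by rewrite /lambda le_max -/h lexx.
have lam_ge' : Num.sqrt (1 - amax * mubar / 3) <= lambda by rewrite /lambda le_max lexx orbT.
have lam_gt0 : 0 < lambda by lra.
have s_gt0 : 0 < amax * mubar by rewrite mulr_gt0.
have lam_lt1 : lambda < 1.
  rewrite /lambda gt_max -/h -/c; apply/andP; split; first by lra.
  rewrite -[ltRHS]sqrtr1 ltr_sqrt//; lra.
split; first by rewrite lam_gt0.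
(* Without coordinates every error is zero; the comparison of [mui] with [Li] below relies on
   [0 < p]. *)
have [p0|p_gt0] := posnP p.
  exists 1; split=> // k; rewrite mul1r; subst p.
  have -> : frob_norm ((atc_diging f W alpha x0 k).1 - const_mx 1 *m xs) = 0.
    by apply/eqP; rewrite frob_norm_eq0 [_ - _]thinmx0.
  by rewrite exprn_ge0// ltW.
have mu_le i : mui i <= Li i by exact: strong_convexity_le_smoothness p_gt0 (hsmooth i) (hconvex i).
have hL i : Li i <= L := le_maxf _ _.
have hmuL i : mui i <= L := le_trans (mu_le i) (hL i).
have mubar_Lbar : mubar <= Lbar by exact: ler_meanf.
have Lbar_L : Lbar <= L by rewrite -[L](meanf_cst n); exact: ler_meanf.
have Lbar_gt0 : 0 < Lbar by exact: lt_le_trans mubar_gt0 _.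
have Lbar2_gt0 : 0 < 2 * Lbar by apply: mulr_gt0.
rewrite ltr_pdivlMr// in amax_Lbar.
have mean_amax : meanf alpha <= amax.
  by rewrite -[amax](meanf_cst n); apply: ler_meanf => i; exact: le_maxf.
have mean_amin : minf alpha <= meanf alpha.
  by rewrite -[minf alpha](meanf_cst n); apply: ler_meanf => i; exact: minf_le.
have [] := @rate_constants R L mubar (minf alpha) (meanf alpha) amax delta lambda.
- by rewrite mubar_gt0 (le_trans mubar_Lbar).
- by [].
- by rewrite mean_amin.
- by [].
- by rewrite lam_lt1 andbT; lra.
- rewrite -kDV -/w -/kbar c4.
  have : c <= q by rewrite -(@ler_pXn2r _ 2) ?nnegrE// q2 lerDl ltW.
  lra.
- rewrite -kDV -/w -/kbar c4.
  (* The product equals [g * amax], where [g] has the extra factor [sqrtn >= 1]. Its factors are at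
     most [lambda - delta] and [lambda - delta - 2 * c]. *)
  apply: (@le_trans _ _ ((q + c) * (q - c))).
    have <- : g * amax = (q + c) * (q - c) by rewrite [RHS]mulrC -subr_sqr q2; ring.
    rewrite ler_pM2r// /g ler_pM2r// ler_peMr//.
    by apply: mulr_ge0 (ltW delta_gt0); apply: mulr_ge0 (ltW L_gt0).
  have : c <= q by rewrite -(@ler_pXn2r _ 2) ?nnegrE// q2 lerDl ltW.
  by move=> cq; apply: ler_pM; lra.
- have [neg|pos] := ltP (1 - amax * mubar / 3) 0.
    by rewrite (le_trans (ltW neg)) ?sqr_ge0.
  by rewrite -[leLHS](sqr_sqrtr pos) lerXn2r ?nnegrE ?sqrtr_ge0// ltW.
- have := ler_wpM2l (ltW amax_gt0) mubar_Lbar; lra.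
move=> P [X [Y [b [[P_gt0 X_gt0 Y_gt0 b_ge0 PX] rate_x rate_b rate_mean rate_y]]]].
have [_ _ hW1] := hW.
apply: (@atc_diging_decay R n p f Li mui xs L W delta alpha (minf alpha) amax lambda P X Y b) => //.
- by move=> i; rewrite minf_le le_maxf.
- have := ler_wpM2r (ltW Lbar_gt0) mean_amax; rewrite -/Lbar; lra.
- have h1 := ler_wpM2r (ltW mubar_gt0) mean_amax.
  have h2 := ler_wpM2l (ltW amax_gt0) mubar_Lbar.
  rewrite -/mubar; lra.
Qed.
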